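(* Let $V$ be a finite set of nodes, every node having degree bound $1$, and let $\mathcal S$ be a finite set of jobs, each job $i$ given by a source $u_i\in V$, a destination $v_i\in V$, size $1$, weight $1$ and a release time $r_i\in\mathbb{N}$. Let $ALG(s)$ be the total flow time $\sum_{i\in\mathcal S}(C_i-r_i)$ of the release-time-ordered greedy maximal matching algorithm (described in the context) run with speed $s$, where $C_i$ is the completion time of job $i$. Let $OPT$ be the optimal total flow time achievable by any schedule with speed $1$. Then for every $\epsilon>0$, $$ALG(2+\epsilon)\le \frac{2(2+\epsilon)}{\epsilon}\cdot OPT.$$
   Context: Time is slotted. In each time slot $t$ a (speed-$1$) schedule chooses a set of released, uncompleted jobs forming a matching on $V$ (each job is an edge $\{u_i,v_i\}$, and each node is an endpoint of at most one chosen job); each chosen job is completed in that slot. The algorithm: at each time $t$, let $G(t)$ be the multigraph of all jobs in the system at time $t$ (released at or before $t$ and not yet completed); order these jobs by release time (ties broken arbitrarily but consistently) and greedily build a maximal matching in this order; these jobs are processed at time $t$. Running with speed $s\ge1$ means the algorithm processes jobs $s$ times faster than a speed-$1$ schedule; in particular, in one time step each node can be the endpoint of up to $s$ processed jobs (the greedy rule in release order is applied with this capacity). The flow time of a job is its completion time minus its release time. *)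

(* Defs.v *)
From HB Require Import structures.
From mathcomp Require Import all_boot all_order all_algebra.
From Stdlib Require Classical_Prop.
Set Implicit Arguments.
Unset Strict Implicit.
Unset Printing Implicit Defensive.
Import Order.TTheory GRing.Theory Num.Theory.
Local Open Scope ring_scope.

Section Model.
Variables (V J : finType) (src dst : J -> V) (r : J -> nat).

(* A job with src i = dst i is allowed; it occupies its node once. *)
Definition incident (i : J) (w : V) : bool := (src i == w) || (dst i == w).

Definition is_matching (A : {set J}) : Prop :=
  forall w : V, (#|[set i in A | incident i w]| <= 1)%N.

(* M t is the set of jobs chosen in slot t. *)
Definition is_schedule (M : nat -> {set J}) : Prop :=
  forall t : nat,
    (forall i : J, i \in M t ->
       (r i <= t)%N /\ (forall t' : nat, (t' < t)%N -> i \notin M t')) /\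
    is_matching (M t).

(* Slot t is the time interval [t, t+1], so a job chosen in slot t is
   complete at time t+1; in particular every job is eventually chosen. *)
Definition schedule_completion (M : nat -> {set J}) (C : J -> nat) : Prop :=
  forall i : J, exists2 t : nat, i \in M t & C i = t.+1.

Definition total_flow (R : realFieldType) (C : J -> nat) : R :=
  \sum_(i : J) ((C i)%:R - (r i)%:R).

Definition achievable (R : realFieldType) (c : R) : Prop :=
  exists M C, [/\ is_schedule M, schedule_completion M C & c = total_flow R C].

Definition is_OPT (R : realFieldType) (c : R) : Prop :=
  achievable c /\ (forall c' : R, achievable c' -> c <= c').

(* The consistent tie-breaking rule is the choice of the list. *)
Definition release_order (order : seq J) : Prop :=
  perm_eq order (enum J) /\ sorted (fun i j => (r i <= r j)%N) order.

Section Algorithm.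
Variables (R : realFieldType) (order : seq J).

(* One slot of the greedy rule.  p i is the work left on job i, cap w the
   capacity left at node w; jobs are taken in the order of the list, and each
   gets as much processing as its own remaining work and the capacity left at
   its two endpoints allow.  With unit work and capacity 1 this is the greedy
   maximal matching; with capacity n : nat it takes a job iff fewer than n jobs
   have been taken before it at either endpoint (greedyE_nat below).  With a
   non-integral capacity the fractional part is used to process a job
   partially. *)
Fixpoint greedy (p : J -> R) (cap : V -> R) (js : seq J) : J -> R :=
  if js is i :: js' then
    let x := Num.min (p i) (Num.min (cap (src i)) (cap (dst i))) in
    let cap' := fun w => if incident i w then cap w - x else cap w in
    fun j => if j == i then x else greedy p cap' js' j
  else fun=> 0.

Definition in_system (p : J -> R) (t : nat) (i : J) : bool :=
  (r i <= t)%N && (0 < p i).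

(* Work left on each job at time t, i.e. at the beginning of slot t, when the
   algorithm runs with speed s. *)
Fixpoint remaining (s : R) (t : nat) : J -> R :=
  if t is t'.+1 then
    let p := remaining s t' in
    fun i => p i - greedy p (fun=> s) [seq j <- order | in_system p t' j] i
  else fun=> 1.

Definition alg_completes_at (s : R) (i : J) (t : nat) : Prop :=
  remaining s t i = 0 /\ (forall t' : nat, (t' < t)%N -> 0 < remaining s t' i).

Definition alg_completion (s : R) (C : J -> nat) : Prop :=
  forall i : J, alg_completes_at s i (C i).

End Algorithm.
End Model.

(* The remaining lemmas show that the notions above are well behaved: for a
   natural speed the algorithm is the literal counting rule, and the completion
   times of the algorithm and OPT exist and are unique. *)

Section Sanity.
Variables (V J : finType) (src dst : J -> V) (r : J -> nat).
Variables (R : realFieldType) (order : seq J).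
Local Notation incident := (incident src dst).
Local Notation greedy := (@greedy V J src dst R).
Local Notation rem := (@remaining V J src dst r R order).

Fixpoint greedy_set (n : nat) (A : {set J}) (js : seq J) : {set J} :=
  if js is i :: js' then
    let free := [forall w, incident i w ==>
                   (#|[set j in A | incident j w]| < n)%N] in
    greedy_set n (if free then i |: A else A) js'
  else A.

Lemma greedy_notin p cap js j : j \notin js -> greedy p cap js j = 0.
Proof.
elim: js cap => //= i js IH cap; rewrite inE negb_or => /andP[/negPf-> jjs].
exact: IH.
Qed.

Lemma greedy_set_notin n A js j :
  j \notin js -> (j \in greedy_set n A js) = (j \in A).
Proof.
elim: js A => //= i js IH A; rewrite inE negb_or => /andP[ji jjs].
by rewrite IH //; case: ifP => // _; rewrite !inE (negPf ji).
Qed.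

Lemma greedyE_nat_gen n (p : J -> R) cap (A : {set J}) js :
  uniq js -> (forall i, i \in js -> p i = 1) ->
  (forall i, i \in js -> i \notin A) ->
  (forall w, (#|[set j in A | incident j w]| <= n)%N /\
     cap w = (n - #|[set j in A | incident j w]|)%:R) ->
  forall j, j \notin A -> greedy p cap js j = (j \in greedy_set n A js)%:R.
Proof.
elim: js cap A => [|i js IH] cap A /=; first by move=> _ _ _ _ j /negPf->.
case/andP=> ijs ujs p1 dA hcap j jA.
have iA : i \notin A by apply: dA; rewrite mem_head.
case: (boolP [forall w, incident i w ==>
               (#|[set j in A | incident j w]| < n)%N])
  => [/forallP fr|/forallPn [w]].
- have lt1 w : incident i w -> 1 <= cap w.
    move=> iw; have := fr w; rewrite iw /= => lt.
    by have [_ ->] := hcap w; rewrite (ler_nat R 1) subn_gt0.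
  have -> : Num.min (p i) (Num.min (cap (src i)) (cap (dst i))) = 1.
    rewrite p1 ?mem_head // min_l // le_min !lt1 // /incident eqxx ?orbT //.
  case: eqVneq => [->|ji].
    by rewrite greedy_set_notin // setU11.
  apply: IH => // [k kjs|k kjs|w|].
  + by apply: p1; rewrite inE kjs orbT.
  + rewrite !inE negb_or dA ?inE ?kjs ?orbT // andbT.
    by apply: contraNneq ijs => <-.
  + have [le_n ->] := hcap w.
    case: ifP => iw; last first.
      suff -> : [set j0 in i |: A | incident j0 w]
             = [set j0 in A | incident j0 w] by [].
      apply/setP => k; rewrite !inE; case: eqVneq => [->|//].
      by rewrite iw !andbF.
    have -> : [set j0 in i |: A | incident j0 w]
           = i |: [set j0 in A | incident j0 w].
      by apply/setP => k; rewrite !inE; case: eqVneq => [->|//]; rewrite iw.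
    have := fr w; rewrite iw /= => lt.
    rewrite cardsU1 inE (negPf iA) /= add1n; split=> //.
    by rewrite subnS -subn1 [in RHS]natrB ?subn_gt0.
  + by rewrite !inE negb_or ji.
- rewrite negb_imply -leqNgt => /andP[iw ge].
  have c0 w' : 0 <= cap w' by have [_ ->] := hcap w'; rewrite ler0n.
  have cw : cap w = 0.
    have [le ->] := hcap w.
    by have -> : (n - #|[set j in A | incident j w]|)%N = 0%N
      by apply/eqP; rewrite subn_eq0.
  have -> : Num.min (p i) (Num.min (cap (src i)) (cap (dst i))) = 0.
    rewrite p1 ?mem_head //; move: iw cw => /orP[]/eqP-> ->.
      by rewrite (min_l (c0 _)) min_r // ler01.
    by rewrite (min_r (c0 _)) min_r // ler01.
  case: eqVneq => [->|ji].
    by rewrite greedy_set_notin // (negPf iA).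
  apply: IH => // [k kjs|k kjs|w'].
  + by apply: p1; rewrite inE kjs orbT.
  + by apply: dA; rewrite inE kjs orbT.
  + have [le ->] := hcap w'; split=> //.
    by rewrite subr0; case: ifP.
Qed.

Lemma greedyE_nat n (p : J -> R) js :
  uniq js -> (forall i, i \in js -> p i = 1) ->
  forall j, greedy p (fun=> n%:R) js j = (j \in greedy_set n set0 js)%:R.
Proof.
move=> ujs p1 j; apply: greedyE_nat_gen => // [k _|w|]; rewrite ?inE //.
suff -> : [set j0 in set0 | incident j0 w] = set0 by rewrite cards0 subn0.
by apply/setP => k; rewrite !inE.
Qed.

Hypothesis order_perm : perm_eq order (enum J).

Lemma remaining_nat n t i : rem n%:R t i = 0 \/ rem n%:R t i = 1.
Proof.
elim: t i => [|t IH] i /=; first by right.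
set p := rem n%:R t; set js := [seq j <- order | _].
have p1 k : k \in js -> p k = 1.
  rewrite mem_filter => /andP[/andP[_ gt0] _].
  by case: (IH k) gt0 => // ; rewrite -/p => ->; rewrite ltxx.
have [ijs|ijs] := boolP (i \in js); last by rewrite greedy_notin // subr0; exact: IH.
have ujs : uniq js by rewrite filter_uniq // (perm_uniq order_perm) enum_uniq.
rewrite greedyE_nat // p1 //; case: (i \in _); first by left; rewrite subrr.
by right; rewrite subr0.
Qed.

Lemma greedy_bound (p : J -> R) cap js i :
  (forall j, 0 <= p j) -> (forall w, 0 <= cap w) ->
  0 <= greedy p cap js i <= p i.
Proof.
move=> p0; elim: js cap => [|k js IH] cap c0 /=; first by rewrite lexx p0.
set x := Num.min _ _.
case: eqVneq => [->|_]; first by rewrite /x !le_min p0 !c0 /= ge_min lexx.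
apply: IH => w; case: ifP => // kw; rewrite subr_ge0 /x !ge_min.
by case/orP: kw => /eqP->; rewrite lexx ?orbT.
Qed.

Lemma remaining_bound s t i : 0 <= s -> 0 <= rem s t i <= 1.
Proof.
move=> s0; elim: t i => [|t IH] i /=; first by rewrite ler01 lexx.
have p0 j : 0 <= rem s t j by have /andP[] := IH j.
have /andP[g0 gp] := @greedy_bound (rem s t) (fun=> s)
  [seq j <- order | in_system r (rem s t) t j] i p0 (fun=> s0).
rewrite subr_ge0 gp /=; have /andP[_ le1] := IH i.
by rewrite (le_trans _ le1) // gerBl.
Qed.

Lemma remaining_le s t t' i :
  0 <= s -> (t <= t')%N -> rem s t' i <= rem s t i.
Proof.
move=> s0 /subnKC <-; elim: (t' - t)%N => [|d IH]; first by rewrite addn0.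
rewrite addnS /=; apply: le_trans IH; rewrite gerBl.
have p0 j : 0 <= rem s (t + d) j by have /andP[] := remaining_bound (t + d) j s0.
by have /andP[] := greedy_bound [seq j <- order | in_system r (rem s (t + d)) (t + d) j] i p0 (fun=> s0).
Qed.

Lemma alg_completion_exists (s : R) :
  1 <= s -> exists C, alg_completion src dst r order s C.
Proof.
move=> s1; have s0 : 0 <= s by exact: le_trans ler01 s1.
pose T := (\max_(i : J) r i)%N; pose L t := [set i | 0 < rem s t i].
have step d : (#|L (T + d)%N| <= #|J| - d)%N.
  elim: d => [|d IH]; first by rewrite subn0 max_card.
  have sub : L (T + d.+1)%N \subset L (T + d)%N.
    apply/subsetP => i; rewrite !inE => /lt_le_trans; apply.
    by apply: remaining_le => //; rewrite leq_add2l.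
  case E : [seq j <- order | in_system r (rem s (T + d)) (T + d) j] => [|i js].
    have -> : L (T + d.+1)%N = set0; last by rewrite cards0.
    apply/eqP; rewrite -subset0; apply: subset_trans sub _.
    apply/subsetP => i; rewrite inE => gt0.
    have : i \in [::] by rewrite -E mem_filter (perm_mem order_perm) mem_enum andbT
      /in_system gt0 andbT (leq_trans _ (leq_addr _ _)) // leq_bigmax.
    by [].
  have iL : i \in L (T + d)%N.
    have : i \in [seq j <- order | in_system r (rem s (T + d)) (T + d) j]
      by rewrite E mem_head.
    by rewrite mem_filter inE => /andP[/andP[]].
  have iL' : i \notin L (T + d.+1)%N.
    rewrite inE addnS /= E /= eqxx minxx min_l ?subrr ?ltxx //.
    by have /andP[_ /le_trans->] := remaining_bound (T + d)%N i s0.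
  rewrite subnS -ltnS; have : L (T + d.+1)%N \proper L (T + d)%N.
    by apply/properP; split=> //; exists i.
  move/proper_card => lt; have := leq_trans lt IH.
  by case: (#|J| - d)%N => //= m; rewrite ltnS.
have fin i : exists t, rem s t i == 0.
  exists (T + #|J|)%N; have := step #|J|; rewrite subnn leqn0 cards_eq0 => /eqP E.
  have : i \notin L (T + #|J|)%N by rewrite E inE.
  rewrite inE -leNgt => le0; rewrite eq_le le0 /=.
  by have /andP[] := remaining_bound (T + #|J|)%N i s0.
exists (fun i => ex_minn (fin i)) => i; case: ex_minnP => m /eqP m0 min; split=> //.
move=> t' lt; rewrite lt_def; have /andP[-> _] := remaining_bound t' i s0.
by rewrite andbT; apply/negP => /min; rewrite leqNgt lt.
Qed.

Lemma alg_completion_unique (s : R) C C' :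
  alg_completion src dst r order s C ->
  alg_completion src dst r order s C' -> C =1 C'.
Proof.
move=> h h' i; have [z l] := h i; have [z' l'] := h' i.
by case: (ltngtP (C i) (C' i)) => // [/l'|/l]; rewrite ?z ?z' ltxx.
Qed.

Lemma is_OPT_unique (c c' : R) :
  is_OPT src dst r c -> is_OPT src dst r c' -> c = c'.
Proof. by case=> a m [a' m']; apply/eqP; rewrite eq_le m // m'. Qed.

Lemma achievable_exists : exists c : R, achievable src dst r c.
Proof.
pose T := (\max_(i : J) r i)%N.
pose sl (i : J) := (T + enum_rank i)%N.
pose M t := [set i | sl i == t].
exists (total_flow r R (fun i => (sl i).+1)), M, (fun i => (sl i).+1).
split=> // [t|i]; last by exists (sl i); rewrite // inE.
split=> [i|w].
  rewrite inE => /eqP <-; split.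
    by rewrite (leq_trans _ (leq_addr _ _)) // leq_bigmax.
  by move=> t' lt; rewrite inE gtn_eqF.
apply: leq_trans (_ : #|M t| <= 1)%N.
  by apply/subset_leq_card/subsetP => i; rewrite inE => /andP[].
apply/card_le1_eqP => i j; rewrite !inE => /eqP <- /eqP/addnI/val_inj.
by move/enum_rank_inj->.
Qed.

Lemma achievable_nat (c : R) :
  achievable src dst r c -> exists n : nat, c = n%:R.
Proof.
case=> M [C [sM cM ->]]; exists (\sum_i (C i - r i))%N.
rewrite /total_flow natr_sum; apply: eq_bigr => i _; rewrite natrB //.
by have [t iM ->] := cM i; have [/(_ i iM)[/leqW]] := sM t.
Qed.

Lemma is_OPT_exists : exists c : R, is_OPT src dst r c.
Proof.
apply: Classical_Prop.NNPP => nex.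
suff H n : ~ achievable src dst r (n%:R : R).
  have [c ac] := achievable_exists; have [n E] := achievable_nat ac.
  by apply: (H n); rewrite -E.
elim/ltn_ind: n => n IH an; apply: nex; exists n%:R; split=> // c' ac.
have [m E] := achievable_nat ac; rewrite E ler_nat leqNgt; apply/negP => lt.
by apply: (IH m lt); rewrite -E.
Qed.

End Sanity.

(* Main.v *)
Require Import Defs.
From mathcomp Require Import all_boot all_order all_algebra.
Import Order.TTheory GRing.Theory Num.Theory.
Local Open Scope ring_scope.

(** Dual fitting.  Suppose a speed-1 schedule runs job [i] in slot [a i].  In
    every slot from [a i] on that leaves [i] unfinished in the algorithm run
    with speed [s], some endpoint of [i] is saturated by jobs released no later
    than [i], which were already in the system at time [a i].  So the delay of
    [i] past slot [a i] is at most [1 / s] times the number of jobs alive at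
    time [a i], counted once for each endpoint shared with [i].  Summed over
    [i], each alive pair (job [j], endpoint [w]) is charged at most once per
    slot, because the jobs of a slot form a matching; hence
    [s (ALG - OPT) <= 2 ALG], which gives even the ratio [s / (s - 2)]. *)

Lemma card_preim_itv_le (T : finType) (P : pred T) (a : T -> nat) (m n : nat) :
  {in P &, injective a} -> (#|[pred i | P i && (m <= a i < n)]| <= n - m)%N.
Proof.
move=> a_inj; rewrite cardE -(size_map a) -(size_iota m (n - m)).
apply: uniq_leq_size => [|t /mapP[i]].
  rewrite map_inj_in_uniq ?enum_uniq // => i k.
  by rewrite !mem_enum => /andP[Pi _] /andP[Pk _]; apply: a_inj.
rewrite mem_enum mem_iota => /andP[_ /andP[le_m lt_n]] ->.
by rewrite le_m subnKC // ltnW // (leq_ltn_trans le_m).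
Qed.

Section ReleaseOrderedGreedy.
Set Implicit Arguments.
Unset Strict Implicit.
Variables (V J : finType) (src dst : J -> V) (R : realFieldType).
Local Notation incident := (incident src dst).
Local Notation greedy := (@greedy V J src dst R).
Implicit Types (i j k : J) (w : V) (x y p : J -> R) (cap : V -> R).

Definition load x w : R := \sum_(j | incident j w) x j.

(* A job sharing both endpoints with [i] counts twice. *)
Definition contention x i : R := \sum_(w | incident i w) load x w.

Lemma ler_load x y w : (forall j, x j <= y j) -> load x w <= load y w.
Proof. by move=> le_xy; apply: ler_sum => j _. Qed.

Lemma load_ge0 x w : (forall j, 0 <= x j) -> 0 <= load x w.
Proof. by move=> x_ge0; apply: sumr_ge0. Qed.

Lemma ler_contention x y i :
  (forall j, x j <= y j) -> contention x i <= contention y i.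
Proof. by move=> le_xy; apply: ler_sum => w _; apply: ler_load. Qed.

Lemma contention_ge0 x i : (forall j, 0 <= x j) -> 0 <= contention x i.
Proof. by move=> x_ge0; apply: sumr_ge0 => w _; apply: load_ge0. Qed.

Lemma contentionD x y i :
  contention (x \+ y) i = contention x i + contention y i.
Proof. by rewrite -big_split; apply: eq_bigr => w _; rewrite -big_split. Qed.

Lemma load_le_contention x i w :
  (forall j, 0 <= x j) -> incident i w -> load x w <= contention x i.
Proof.
move=> x_ge0 iw; rewrite /contention (bigD1 w) //= lerDl.
by apply: sumr_ge0 => w' _; apply: load_ge0.
Qed.

Lemma card_endpoints_le2 i : (#|[pred w | incident i w]| <= 2)%N.
Proof.
apply: (@leq_trans #|[set src i; dst i]|); last by rewrite cards2; case: eqP.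
by apply/subset_leq_card/subsetP => w; rewrite !inE ![w == _]eq_sym.
Qed.

Lemma contention_le x i (b : R) :
  0 <= b -> (forall w, load x w <= b) -> contention x i <= 2 * b.
Proof.
move=> b_ge0 le_b; apply: (@le_trans _ _ (\sum_(w | incident i w) b)).
  by apply: ler_sum.
by rewrite sumr_const -[leLHS]mulr_natl ler_wpM2r // ler_nat card_endpoints_le2.
Qed.

(* Sharing an endpoint is symmetric. *)
Lemma exchange_contention (x : J -> J -> R) :
  \sum_i contention (x i) i = \sum_j contention (x^~ j) j.
Proof.
rewrite /contention /load (exchange_big_dep xpredT) //=.
rewrite [RHS](exchange_big_dep xpredT) //=.
by apply: eq_bigr => w _; rewrite exchange_big.
Qed.

Definition grant p cap k : R :=
  Num.min (p k) (Num.min (cap (src k)) (cap (dst k))).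

Definition residual p cap k : V -> R :=
  fun w => if incident k w then cap w - grant p cap k else cap w.

Lemma residual_ge0 p cap k :
  (forall w, 0 <= cap w) -> forall w, 0 <= residual p cap k w.
Proof.
move=> cap_ge0 w; rewrite /residual; case: ifP => // kw.
by rewrite subr_ge0 !ge_min; case/orP: kw => /eqP->; rewrite lexx ?orbT.
Qed.

Lemma grant_saturates p cap k :
  grant p cap k < p k -> exists2 w, incident k w & grant p cap k = cap w.
Proof.
rewrite gt_min ltxx /= => /ltW cap_lt; rewrite /grant min_r //.
case: leP => _; [exists (src k) | exists (dst k)] => //;
  by rewrite /Defs.incident eqxx ?orbT.
Qed.

Lemma load_greedy_cons (D : pred J) p cap k js w :
  k \notin js ->
  load (fun j => greedy p cap (k :: js) j *+ D j) w =
    grant p cap k *+ (incident k w && D k) +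
    load (fun j => greedy p (residual p cap k) js j *+ D j) w.
Proof.
move=> kjs; rewrite /load big_mkcond [in RHS]big_mkcond /=.
rewrite (bigD1 k) // [in RHS](bigD1 k) //= eqxx greedy_notin // mul0rn.
rewrite if_same add0r; congr (_ + _); first by case: (incident k w).
by apply: eq_bigr => j /negPf->.
Qed.

Lemma greedy_saturates (e : rel J) p cap js i :
  reflexive e -> pairwise e js -> uniq js ->
  (forall j, 0 <= p j) -> (forall w, 0 <= cap w) ->
  i \in js -> greedy p cap js i < p i ->
  exists2 w, incident i w &
    cap w <= load (fun j => greedy p cap js j *+ e j i) w.
Proof.
move=> e_refl + + p_ge0.
elim: js cap => // k js IH cap /andP[/allP e_k e_js] /andP[kjs js_uniq] cap_ge0.
have res_ge0 := residual_ge0 p k cap_ge0.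
rewrite inE [greedy _ _ _ i]/=; case: eqVneq => [-> _|_ /= ijs] unmet.
  have [w kw eq_cap] := grant_saturates unmet; exists w => //.
  rewrite load_greedy_cons // kw e_refl eq_cap lerDl; apply: load_ge0 => j.
  have /andP[served_ge0 _] := greedy_bound src dst js j p_ge0 res_ge0.
  by rewrite mulrn_wge0.
have [w iw cap_le] := IH _ e_js js_uniq res_ge0 ijs unmet; exists w => //.
rewrite load_greedy_cons // (e_k i ijs) andbT -lerBlDl; apply: le_trans cap_le.
by rewrite /residual; case: ifP; rewrite ?subr0.
Qed.

Variable r : J -> nat.

Lemma schedule_slot_inj M (a : J -> nat) w :
  is_schedule src dst r M -> (forall i, i \in M (a i)) ->
  {in [pred i | incident i w] &, injective a}.
Proof.
move=> hM Ma i k iw kw eq_a; have [_ /(_ w)/card_le1_eqP] := hM (a i).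
by rewrite !inE in iw kw; apply; rewrite inE ?Ma ?iw // eq_a Ma kw.
Qed.

Lemma load_slots_le M (a : J -> nat) (m n : nat) w :
  is_schedule src dst r M -> (forall i, i \in M (a i)) ->
  load (fun i => (m <= a i < n)%:R) w <= (n - m)%N%:R.
Proof.
move=> hM Ma; rewrite /load; under eq_bigr => i _ do rewrite mulrb.
rewrite -big_mkcondr sumr_const ler_nat.
exact: card_preim_itv_le (schedule_slot_inj hM Ma).
Qed.

Definition alive (C : J -> nat) (t : nat) j : bool := (r j <= t < C j)%N.

Lemma sum_contention_alive_le M (a C : J -> nat) :
  is_schedule src dst r M -> (forall i, i \in M (a i)) ->
  (forall i, (r i <= C i)%N) ->
  \sum_i contention (fun j => (alive C (a i) j)%:R) i <= 2 * total_flow r R C.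
Proof.
move=> hM Ma le_rC; rewrite exchange_contention mulr_sumr.
apply: ler_sum => j _; rewrite -natrB //.
by apply: contention_le => // w; apply: load_slots_le hM Ma.
Qed.

Variables (order : seq J) (s : R).
Hypotheses (order_release : release_order r order) (s_ge0 : 0 <= s).
Local Notation rem := (@remaining V J src dst r R order s).

Lemma remaining_ge0 t i : 0 <= rem t i.
Proof. by have /andP[] := remaining_bound src dst r order t i s_ge0. Qed.

Lemma remaining_before_release t i : (t <= r i)%N -> rem t i = 1.
Proof.
elim: t => // t IH lt_t_ri /=; rewrite greedy_notin ?subr0.
  exact: IH (ltnW lt_t_ri).
by rewrite mem_filter /in_system leqNgt lt_t_ri.
Qed.

Definition served (t : nat) : J -> R :=
  greedy (rem t) (fun=> s) [seq j <- order | in_system r (rem t) t j].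

Lemma served_ge0 t i : 0 <= served t i.
Proof.
rewrite /served; set js := [seq j <- order | _].
have cap_ge0 (w : V) : 0 <= s by [].
by have /andP[] := greedy_bound src dst js i (remaining_ge0 t) cap_ge0.
Qed.

Lemma served_saturates t i :
  (r i <= t)%N -> 0 < rem t.+1 i ->
  exists2 w, incident i w &
    s <= load (fun j => served t j *+ (r j <= r i)%N) w.
Proof.
move=> le_ri_t rem_gt0; have [order_perm order_sorted] := order_release.
have r_trans : transitive (fun i j => (r i <= r j)%N).
  by move=> ? ? ?; apply: leq_trans.
apply: (@greedy_saturates (fun i j => (r i <= r j)%N)) => //.
- by rewrite -(sorted_pairwise r_trans) sorted_filter.
- by rewrite filter_uniq // (perm_uniq order_perm) enum_uniq.
- exact: remaining_ge0.
- rewrite mem_filter (perm_mem order_perm) mem_enum andbT /in_system le_ri_t /=.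
  by apply: lt_le_trans rem_gt0 _; apply: remaining_le.
- by move: rem_gt0; rewrite /= subr_gt0.
Qed.

(* In release order, only this work can keep [i] from using its endpoints. *)
Definition backlog i (t : nat) : R :=
  contention (fun j => rem t j *+ (r j <= r i)%N) i.

Lemma backlog_ge0 i t : 0 <= backlog i t.
Proof. by apply: contention_ge0 => j; rewrite mulrn_wge0 // remaining_ge0. Qed.

Lemma backlog_decrease i t :
  (r i <= t)%N -> 0 < rem t.+1 i -> backlog i t.+1 + s <= backlog i t.
Proof.
move=> le_ri_t rem_gt0; have [w iw le_s] := served_saturates le_ri_t rem_gt0.
have earlier_served_ge0 j : 0 <= served t j *+ (r j <= r i)%N.
  by rewrite mulrn_wge0 // served_ge0.
have := le_trans le_s (load_le_contention earlier_served_ge0 iw).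
rewrite -(lerD2l (backlog i t.+1)) -contentionD => /le_trans -> //.
by apply: ler_contention => j /=; rewrite -mulrnDl subrK.
Qed.

Variable C : J -> nat.
Hypothesis C_completion : alg_completion src dst r order s C.

Lemma release_lt_completion i : (r i < C i)%N.
Proof.
have [/eqP rem0 _] := C_completion i; rewrite ltnNge.
apply: contraTN rem0 => le_Cr.
by rewrite remaining_before_release // oner_eq0.
Qed.

Lemma delay_le_backlog i t d :
  (r i <= t)%N -> (t + d < C i)%N -> s * d%:R <= backlog i t.
Proof.
elim: d t => [|d IH] t le_ri_t lt_C; first by rewrite mulr0 backlog_ge0.
rewrite -natr1 mulrDr mulr1.
have rem_gt0 : 0 < rem t.+1 i.
  have [_] := C_completion i; apply; apply: leq_ltn_trans lt_C.
  by rewrite addnS ltnS leq_addr.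
apply: le_trans (backlog_decrease le_ri_t rem_gt0); rewrite lerD2r.
by apply: IH (leqW le_ri_t) _; rewrite addSnnS.
Qed.

Lemma backlog_le_alive i t :
  (r i <= t)%N -> backlog i t <= contention (fun j => (alive C t j)%:R) i.
Proof.
move=> le_ri_t; apply: ler_contention => j; rewrite /alive.
case: (leqP (r j) (r i)) => [rji|_]; last by rewrite mulr0n ler0n.
rewrite (leq_trans rji le_ri_t) /=; case: ltnP => [_|le_C].
  by have /andP[] := remaining_bound src dst r order t j s_ge0.
have [rem0 _] := C_completion j.
by rewrite mulr0n mulr1n -rem0; apply: remaining_le.
Qed.

Lemma delay_le_alive i t :
  (r i <= t)%N ->
  s * ((C i)%:R - t.+1%:R) <= contention (fun j => (alive C t j)%:R) i.
Proof.
move=> le_ri_t; apply: le_trans (backlog_le_alive le_ri_t).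
case: (leqP (C i) t.+1) => [le_C|lt_C].
  apply: le_trans (backlog_ge0 i t).
  by rewrite mulr_ge0_le0 // subr_le0 ler_nat.
rewrite -natrB 1?ltnW //; apply: delay_le_backlog => //.
by rewrite -ltnS -addSn subnKC // ltnW.
Qed.

Lemma total_delay_le M C' :
  is_schedule src dst r M -> schedule_completion M C' ->
  s * (total_flow r R C - total_flow r R C') <= 2 * total_flow r R C.
Proof.
move=> hM hC'.
have MC' i : i \in M (C' i).-1 by have [t it ->] := hC' i.
have C'_gt0 i : (0 < C' i)%N by have [t _ ->] := hC' i.
have rC' i : (r i <= (C' i).-1)%N by have [/(_ i (MC' i))[]] := hM (C' i).-1.
have le_rC i : (r i <= C i)%N by rewrite ltnW // release_lt_completion.
apply: le_trans (sum_contention_alive_le hM MC' le_rC).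
rewrite -sumrB mulr_sumr; apply: ler_sum => i _.
have -> : (C i)%:R - (r i)%:R - ((C' i)%:R - (r i)%:R)
        = (C i)%:R - ((C' i).-1).+1%:R :> R.
  by rewrite prednK // opprB addrA subrK.
exact: delay_le_alive.
Qed.

Lemma total_flow_competitive M C' :
  2 < s -> is_schedule src dst r M -> schedule_completion M C' ->
  total_flow r R C <= s / (s - 2) * total_flow r R C'.
Proof.
move=> s_gt2 hM hC'; have := total_delay_le hM hC'; rewrite mulrBr => delay.
rewrite mulrAC ler_pdivlMr ?subr_gt0 // [leLHS]mulrC mulrBl.
by rewrite lerBlDr -lerBlDl.
Qed.

End ReleaseOrderedGreedy.

Theorem theorem1 (R : realFieldType) (V J : finType) (src dst : J -> V)
    (r : J -> nat) (order : seq J) (horder : release_order r order)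
    (eps : R) (heps : 0 < eps)
    (C : J -> nat) (hC : alg_completion src dst r order (2 + eps) C)
    (OPT : R) (hOPT : is_OPT src dst r OPT) :
  total_flow r R C <= 2 * (2 + eps) / eps * OPT.
Proof.
have s_gt2 : 2 < 2 + eps by rewrite ltrDl.
have s_ge0 : 0 <= 2 + eps by rewrite ltW // addr_gt0.
have [OPT_achievable _] := hOPT.
have OPT_ge0 : 0 <= OPT.
  by have [n ->] := achievable_nat OPT_achievable; apply: ler0n.
have [M [C' [hM hC' eqOPT]]] := OPT_achievable.
have := total_flow_competitive horder s_ge0 hC s_gt2 hM hC'.
rewrite -eqOPT [2 + eps - 2]addrAC subrr add0r => /le_trans -> //.
by rewrite -!mulrA ler_peMl ?ler1n // !mulr_ge0 // invr_ge0 ltW.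
Qed.
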